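(* Let $k>1$ be an integer. Then all positive integer solutions $(x,y)$ of the equation $x^{2}-(k^{2}+4)y^{2}=-4$ are given by $$(x,y)=(V_{2n-1}(k,1),U_{2n-1}(k,1))$$ with $n\geq 1$. That is, the set of pairs of positive integers solving the equation is exactly the set of these pairs as $n$ ranges over the integers $n\ge 1$.
   Context: For nonzero integers $k,s$ with $k^{2}+4s>0$, the generalized Fibonacci sequence is defined by $U_{0}(k,s)=0$, $U_{1}(k,s)=1$, $U_{n+1}(k,s)=kU_{n}(k,s)+sU_{n-1}(k,s)$ for $n\ge 1$, and the generalized Lucas sequence by $V_{0}(k,s)=2$, $V_{1}(k,s)=k$, $V_{n+1}(k,s)=kV_{n}(k,s)+sV_{n-1}(k,s)$ for $n\ge 1$. *)

(* Defs.v *)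
From mathcomp Require Import all_boot all_order all_algebra.

Set Implicit Arguments.
Unset Strict Implicit.
Unset Printing Implicit Defensive.

Import Order.TTheory GRing.Theory Num.Theory.
Local Open Scope ring_scope.

(* Defined for all integers k, s; the usual standing assumptions k, s != 0 and
   k ^+ 2 + 4 * s > 0 are not needed for the recurrences to make sense, and
   hold whenever k != 0 and s = 1. *)
Fixpoint genFib (k s : int) (n : nat) : int :=
  match n with
  | 0 => 0
  | m.+1 => match m with
            | 0 => 1
            | p.+1 => k * genFib k s m + s * genFib k s p
            end
  end.

Fixpoint genLucas (k s : int) (n : nat) : int :=
  match n with
  | 0 => 2
  | m.+1 => match m with
            | 0 => k
            | p.+1 => k * genLucas k s m + s * genLucas k s p
            end
  end.

(* Main.v *)
Require Import Defs.
From mathcomp Require Import all_boot all_order all_algebra.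
From mathcomp Require Import zify ring.
Import Order.TTheory GRing.Theory Num.Theory.
Local Open Scope ring_scope.

(** Write [U] and [V] for [genFib k 1] and [genLucas k 1].  A solution has
    [x] and [k * y] of the same parity, so [x = k * y + 2 * z] for an integer
    [z], and in the coordinates [(y, z)] the equation becomes
    [y ^+ 2 - k * y * z - z ^+ 2 = 1]; moreover [x, y > 0] amounts to [y > 0]
    and [z >= 0].  As [V (n+1) = k * U (n+1) + 2 * U n]
    ([genLucasS_genFib]), the claim is that the solutions [(y, z)] of the
    reduced equation are exactly the pairs [(U (2m+1), U (2m))].

    These pairs are solutions because the map [(y, z) |-> (k * y + z, y)],
    which takes [(U (n+1), U n)] to [(U (n+2), U (n+1))], changes the sign of
    the form [y ^+ 2 - k * y * z - z ^+ 2] ([genFib_cassini]).  Conversely,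
    applying the inverse map twice to a solution with [z > 0] gives a
    solution with a smaller [y] that still satisfies the sign conditions; this
    infinite descent stops only at [(1, 0) = (U 1, U 0)]
    ([genFib_of_reduced]). *)

Lemma genFibSS (k s : int) (n : nat) :
  genFib k s n.+2 = k * genFib k s n.+1 + s * genFib k s n.
Proof. by []. Qed.

Lemma genLucasSS (k s : int) (n : nat) :
  genLucas k s n.+2 = k * genLucas k s n.+1 + s * genLucas k s n.
Proof. by []. Qed.

Lemma genLucasS_genFib (k s : int) (n : nat) :
  genLucas k s n.+1 = k * genFib k s n.+1 + 2 * s * genFib k s n.
Proof.
(* Both sides satisfy the same recurrence of order two, so the induction
   carries two consecutive indices. *)
suff: genLucas k s n.+1 = k * genFib k s n.+1 + 2 * s * genFib k s n /\
      genLucas k s n.+2 = k * genFib k s n.+2 + 2 * s * genFib k s n.+1.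
  by case.
elim: n => [|n [IH1 IH2]]; first by rewrite /=; split; ring.
by split=> //; rewrite genLucasSS IH2 IH1 !genFibSS; ring.
Qed.

Lemma genFib_ge0_gt0 (k s : int) (n : nat) :
  0 < k -> 0 <= s -> 0 <= genFib k s n /\ 0 < genFib k s n.+1.
Proof.
move=> k_gt0 s_ge0; elim: n => [|n [U0 U1]] //; split; first exact: ltW.
by rewrite genFibSS ltr_wpDr ?mulr_gt0 ?mulr_ge0.
Qed.

(** Cassini's identity, with the middle term [U (n+2) * U n] expanded by the
    recurrence so that it becomes a value of the quadratic form. *)
Lemma genFib_cassini (k s : int) (n : nat) :
  genFib k s n.+1 ^+ 2 - k * genFib k s n.+1 * genFib k s n
    - s * genFib k s n ^+ 2 = (- s) ^+ n.
Proof.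
elim: n => [|n IH]; first by rewrite /= expr0; ring.
by rewrite [in RHS]exprS -IH genFibSS; ring.
Qed.

(** The descent: [(y, z) |-> (w, v)] with [w = y - k * z] and [v = z - k * w]
    undoes two steps of the recurrence.  The equation itself supplies the
    signs: [y * w = z ^+ 2 + 1] forces [w > 0], then [z * v = w ^+ 2 - 1]
    forces [v >= 0]. *)
Lemma genFib_of_reduced (k y z : int) :
  0 < k -> 0 < y -> 0 <= z -> y ^+ 2 - k * y * z - z ^+ 2 = 1 ->
  exists m : nat, y = genFib k 1 m.*2.+1 /\ z = genFib k 1 m.*2.
Proof.
move=> k_gt0; have [N] := ubnP `|y|%N.
elim: N y z => // N IH y z ltyN y_gt0 z_ge0 eqyz.
have [z0|z_neq0] := eqVneq z 0.
  exists 0%N; split=> //=; rewrite z0 in eqyz; nia.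
have z_gt0 : 0 < z by rewrite lt_def z_neq0.
pose w := y - k * z; pose v := z - k * w.
have eqyw : y * w = z ^+ 2 + 1 by rewrite /w -eqyz; ring.
have w_gt0 : 0 < w by rewrite -(pmulr_rgt0 _ y_gt0) eqyw; nia.
have eqzv : z * v = w ^+ 2 - 1.
  have -> : z * v = w ^+ 2 - (y ^+ 2 - k * y * z - z ^+ 2).
    by rewrite /v /w; ring.
  by rewrite eqyz.
have v_ge0 : 0 <= v by rewrite -(pmulr_rge0 _ z_gt0) eqzv; nia.
have eqwv : w ^+ 2 - k * w * v - v ^+ 2 = 1 by rewrite -eqyz /v /w; ring.
have lt_wy : w < y by rewrite /w ltrBlDr ltrDl mulr_gt0.
have [||||m [wE vE]] := IH w v => //; first by lia.
have zE : z = genFib k 1 m.*2.+2 by rewrite genFibSS -wE -vE /v; ring.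
exists m.+1; rewrite doubleS; split=> //.
by rewrite genFibSS -zE -wE /w; ring.
Qed.

(** Modulo 4 the equation says [x ^+ 2 = (k * y) ^+ 2], and the square of an
    integer determines its parity. *)
Lemma pell_same_parity (k x y : int) :
  x ^+ 2 - (k ^+ 2 + 4) * y ^+ 2 = - 4 -> exists z, x = k * y + 2 * z.
Proof.
move=> eqxy; pose t := x - k * y.
have eqt : t * t = 4 * (y * y - 1) - 2 * (t * (k * y)).
  by have := eqxy; rewrite /t; lia.
have even_t : (t %% 2)%Z = 0.
  have tE : t = 2 * (t %/ 2)%Z + (t %% 2)%Z by rewrite mulrC -divz_eq.
  have [//|r1] : (t %% 2)%Z = 0 \/ (t %% 2)%Z = 1 by lia.
  move: eqt; rewrite {1 2}tE r1; lia.
exists (t %/ 2)%Z.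
have : t = 2 * (t %/ 2)%Z by rewrite {1}(divz_eq t 2) even_t addr0 mulrC.
by rewrite {1}/t => <-; rewrite addrC subrK.
Qed.

Lemma pell_reduced (k y z : int) :
  (k * y + 2 * z) ^+ 2 - (k ^+ 2 + 4) * y ^+ 2
    = - 4 * (y ^+ 2 - k * y * z - z ^+ 2).
Proof. by ring. Qed.

Theorem theorem11 (k : int) (hk : 1 < k) (x y : int) :
  (0 < x /\ 0 < y /\ x ^+ 2 - (k ^+ 2 + 4) * y ^+ 2 = - 4) <->
  (exists n : nat, (1 <= n)%N /\
     x = genLucas k 1 (2 * n - 1)%N /\ y = genFib k 1 (2 * n - 1)%N).
Proof.
have k_gt0 : 0 < k by exact: lt_trans hk.
have idxE m : (2 * m.+1 - 1)%N = m.*2.+1 by lia.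
split=> [[x_gt0 [y_gt0 eqxy]]|[[|m] [// _ [-> ->]]]]; last first.
  rewrite idxE genLucasS_genFib mulr1.
  have [U0 U1] := genFib_ge0_gt0 k 1 m.*2 k_gt0 ler01.
  split; first by rewrite ltr_wpDr ?mulr_gt0 ?mulr_ge0.
  split=> //; rewrite pell_reduced.
  have := genFib_cassini k 1 m.*2.
  by rewrite mul1r -mul2n exprM sqrrN !expr1n => ->; rewrite mulr1.
have [z xE] := pell_same_parity k x y eqxy.
have eqyz : y ^+ 2 - k * y * z - z ^+ 2 = 1.
  by move: eqxy; rewrite xE pell_reduced; lia.
(* If [z < 0] then [k * y + z > - z > 0], so the product [z * (k * y + z)],
   which equals [y ^+ 2 - 1], would be negative. *)
have z_ge0 : 0 <= z.
  rewrite leNgt; apply/negP => z_lt0.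
  have : z * (k * y + z) < 0 by rewrite nmulr_rlt0 //; lia.
  have -> : z * (k * y + z) = y ^+ 2 - 1 by rewrite -eqyz; ring.
  nia.
have [m [yE zE]] := genFib_of_reduced k y z k_gt0 y_gt0 z_ge0 eqyz.
exists m.+1; rewrite idxE genLucasS_genFib mulr1 -yE -zE.
by split.
Qed.
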